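(* Suppose that $f(z)=\sum_{k=0}^\infty a_k z^k$ is analytic in $\mathbb{D}$ and $|f(z)|\le 1$ in $\mathbb{D}$. Then $$|a_0|+\sum_{k=1}^\infty\left(|a_k|+\frac12|a_k|^2\right)r^k\le 1\quad\text{for } r\le\frac13,$$ and the numbers $1/3$ and $1/2$ cannot be improved (neither the radius $1/3$ nor the coefficient $1/2$ of $|a_k|^2$ can be replaced by a larger number, the other being kept, so that the inequality still holds for all such $f$).
   Context: $\mathbb{D}=\{z\in\mathbb{C}:|z|<1\}$ is the open unit disk, and $0\le r<1$. *)

(* Defs.v *)
(* Stdlib reals with Coquelicot. *)
From Stdlib Require Export Reals.
From Coquelicot Require Export Coquelicot.
Open Scope R_scope.

Definition analytic_on_disk (f : C -> C) : Prop :=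
  forall z : C, Cmod z < 1 -> @ex_derive C_AbsRing C_NormedModule f z.

Definition disk_expansion (f : C -> C) (a : nat -> C) : Prop :=
  forall z : C, Cmod z < 1 -> @is_pseries C_AbsRing C_NormedModule a z (f z).

Definition bounded_by_1_on_disk (f : C -> C) : Prop :=
  forall z : C, Cmod z < 1 -> Cmod (f z) <= 1.

(* Index n stands for k = n + 1. *)
Definition bohr_term (c : R) (a : nat -> C) (r : R) (n : nat) : R :=
  (Cmod (a (S n)) + c * Cmod (a (S n)) ^ 2) * r ^ (S n).

(* [Series] is total, so convergence has to be asserted separately.  When
   |f| <= 1 on the disk, the coefficients satisfy |a_k| <= 1, so convergence is automatic for every
   r < 1 and the negation of this property always concerns the bound itself. *)
Definition bohr_ineq (c : R) (a : nat -> C) (r : R) : Prop :=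
  ex_series (bohr_term c a r) /\ Cmod (a 0%nat) + Series (bohr_term c a r) <= 1.

Definition bohr_holds (c rho : R) : Prop :=
  forall (f : C -> C) (a : nat -> C),
    analytic_on_disk f -> disk_expansion f a -> bounded_by_1_on_disk f ->
    forall r : R, 0 <= r < 1 -> r <= rho -> bohr_ineq c a r.

(* Main.v *)
Require Import Defs.
From Stdlib Require Import Lra Lia Psatz.

(** Write x_k = |a_k| and a = x_0.

    Using only |a_k| <= 1 - a^2 is too weak: near a = 1 the squared terms then
    push the sum above 1.  The quadratic information needed is
      sum_(k >= 1) x_k^2 rho^k <= rho (1 - a^2)^2 / (1 - rho a^2)   for rho <= 1,
    an equality for the disk automorphisms (a - z) / (1 - a z).  It comes from
    Parseval alone.  Multiplication by f does not increase the norm of the Hardy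
    space H^2; testing this on al + be z^(n+1) and keeping the coefficients up to
    degree n+1 ([product_coef_sum_le]) gives, for the best al and be,
      x_(n+1)^2 <= (1 - a^2) D_n,   D_n = 1 - (x_0^2 + ... + x_n^2)
    ([coef_defect]).  This one-step inequality on the defects D_n telescopes to
    the weighted bound ([weighted_square_sum]).  Parseval itself is used in the
    discrete form: the mean of |P|^2 over enough roots of unity is the sum of the
    squared moduli of the coefficients of the polynomial P ([poly_parseval]), and
    f is approximated uniformly on circles by its partial sums.

    The linear part is recovered from the quadratic one by Cauchy-Schwarz with
    weights.  For r <= a the weight rho = r / a makes it an equality on the
    automorphisms, and gives sum_(k >= 1) x_k r^k <= r (1 - a^2) / (1 - r a)
    ([linear_sum_large_head]).  With r = 1/3 the total is then at most
      a + (1 - a^2) / (3 - a) + (1 - a^2)^2 / (2 (3 - a^2)),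
    and 1 minus this is a positive multiple of (1 - a)^3.  For a < 1/3 there is
    so much room that the weight rho = 1 suffices.

    Sharpness is read off the automorphisms as a tends to 1.  Their sum exceeds 1
    by a quantity of first order in 1 - a when r > 1/3; when r = 1/3 the first
    order vanishes, and the second order has the sign of c - 1/2. *)

(** * Roots of unity *)

Definition cis (x : R) : C := (cos x, sin x).

Lemma cis_plus (x y : R) : cis (x + y) = (cis x * cis y)%C.
Proof.
  unfold cis, Cmult; simpl. rewrite cos_plus, sin_plus. f_equal; ring.
Qed.

Lemma cis_pow (x : R) (n : nat) : (cis x ^ n)%C = cis (INR n * x).
Proof.
  induction n as [|n IH].
  - simpl. unfold cis. rewrite Rmult_0_l, cos_0, sin_0. reflexivity.
  - rewrite Cpow_S, IH, <- cis_plus, S_INR. f_equal. ring.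
Qed.

Lemma cis_conj_r (x : R) : (cis x * Cconj (cis x))%C = 1.
Proof.
  unfold cis, Cmult, Cconj, RtoC; simpl.
  pose proof (sin2_cos2 x) as H. unfold Rsqr in H. f_equal; nra.
Qed.

Lemma Cmod_cis (x : R) : Cmod (cis x) = 1.
Proof.
  pose proof (Cmod2_conj (cis x)) as H. rewrite cis_conj_r in H.
  apply RtoC_inj in H. pose proof (Cmod_ge_0 (cis x)). nra.
Qed.

Lemma cis_neq_1 (x : R) : 0 < x < 2 * PI -> cis x <> 1.
Proof.
  intros Hx E. injection E as E _.
  replace x with (2 * (x / 2)) in E by field.
  rewrite cos_2a_sin in E.
  assert (0 < sin (x / 2)) by (apply sin_gt_0; lra). nra.
Qed.

Definition unity_root (m : nat) : C := cis (2 * PI / INR (S m)).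

Lemma unity_root_pow (m : nat) : (unity_root m ^ S m)%C = 1.
Proof.
  unfold unity_root. rewrite cis_pow.
  replace (INR (S m) * (2 * PI / INR (S m))) with (2 * PI)
    by (field; apply not_0_INR; lia).
  unfold cis. rewrite cos_2PI, sin_2PI. reflexivity.
Qed.

Lemma unity_root_primitive (m d : nat) :
  (0 < d <= m)%nat -> (unity_root m ^ d)%C <> 1.
Proof.
  intros Hd. unfold unity_root. rewrite cis_pow. apply cis_neq_1.
  pose proof PI_RGT_0 as Hpi.
  assert (Hm : 0 < INR (S m)) by (apply lt_0_INR; lia).
  assert (Hd0 : 0 < INR d) by (apply lt_0_INR; lia).
  assert (Hdm : INR d < INR (S m)) by (apply lt_INR; lia).
  assert (E : INR d * (2 * PI / INR (S m)) = 2 * PI * (INR d / INR (S m)))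
    by (field; lra).
  assert (0 < INR d / INR (S m)) by (apply Rdiv_lt_0_compat; lra).
  assert (INR d / INR (S m) < 1) by (apply (Rdiv_lt_1 _ _ Hm); lra).
  rewrite E. split; nra.
Qed.

(** * Finite complex sums and orthogonality *)

(** [sum_n] pinned to the carrier [C], so that the field operations of [C] apply
    to its values without unfolding the additive structure. *)
Definition Csum (u : nat -> C) (n : nat) : C := sum_n u n.

Lemma Csum_ext (u v : nat -> C) (n : nat) :
  (forall k, (k <= n)%nat -> u k = v k) -> Csum u n = Csum v n.
Proof. exact (sum_n_ext_loc u v n). Qed.

Lemma Csum_switch (u : nat -> nat -> C) (m n : nat) :
  Csum (fun j => Csum (u j) n) m = Csum (fun k => Csum (fun j => u j k) m) n.
Proof. exact (sum_n_switch u m n). Qed.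

Lemma Csum_Sn (u : nat -> C) (n : nat) :
  Csum u (S n) = (Csum u n + u (S n))%C.
Proof. exact (sum_Sn u n). Qed.

Lemma Csum_O (u : nat -> C) : Csum u 0 = u 0%nat.
Proof. exact (sum_O u). Qed.

Lemma Csum_mult_r (u : nat -> C) (c : C) (n : nat) :
  Csum (fun k => u k * c)%C n = (Csum u n * c)%C.
Proof. exact (sum_n_mult_r c u n). Qed.

Lemma Re_sum (u : nat -> C) (n : nat) :
  Re (Csum u n) = sum_f_R0 (fun k => Re (u k)) n.
Proof.
  induction n as [|n IH].
  - now rewrite Csum_O.
  - rewrite Csum_Sn. simpl sum_f_R0. rewrite <- IH. reflexivity.
Qed.

Lemma geometric_sum_root (v : C) (m : nat) :
  v <> 1 -> (v ^ S m)%C = 1 -> Csum (fun j => v ^ j)%C m = 0.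
Proof.
  intros Hv Hm.
  assert (G : forall n, ((1 - v) * Csum (fun j => v ^ j)%C n)%C = (1 - v ^ S n)%C).
  { induction n as [|n IH].
    - rewrite Csum_O. simpl. ring.
    - rewrite Csum_Sn, Cmult_plus_distr_l, IH, !Cpow_S. ring. }
  specialize (G m). rewrite Hm in G.
  assert (H1 : (1 - v)%C <> 0).
  { intro E. apply Hv. replace v with (1 - (1 - v))%C by ring. rewrite E. ring. }
  replace (Csum (fun j => v ^ j)%C m)
    with (/ (1 - v) * ((1 - v) * Csum (fun j => v ^ j)%C m))%C by (field; exact H1).
  rewrite G. ring.
Qed.

(** For k < l the summand is the j-th power of conj(w)^(l-k), an (m+1)-th root of
    unity that differs from 1 because l - k <= m. *)
Lemma unity_root_orthogonal (m k l : nat) :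
  (k < l <= m)%nat ->
  Csum (fun j => (unity_root m ^ j) ^ k * Cconj ((unity_root m ^ j) ^ l))%C m = 0.
Proof.
  intros Hkl. set (w := unity_root m).
  assert (Hw : (w * Cconj w)%C = 1) by apply cis_conj_r.
  set (v := (Cconj w ^ (l - k))%C).
  rewrite (Csum_ext _ (fun j => v ^ j)%C).
  - apply geometric_sum_root.
    + unfold v. rewrite <- Cpow_conj. intro E.
      apply (unity_root_primitive m (l - k)); [lia|].
      fold w. rewrite <- (Cconj_conj (w ^ (l - k))%C), E.
      unfold Cconj, RtoC; simpl. f_equal. ring.
    + unfold v. rewrite <- Cpow_conj, <- Cpow_conj, <- Cpow_mult_r, Nat.mul_comm, Cpow_mult_r.
      unfold w. rewrite unity_root_pow, Cpow_1_l.
      unfold Cconj, RtoC; simpl. f_equal. ring.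
  - intros j _. unfold v.
    rewrite !Cpow_conj, <- !Cpow_mult_r.
    replace (j * l)%nat with (j * k + j * (l - k))%nat by nia.
    rewrite Cpow_add_r, Cmult_assoc, <- Cpow_mult_l, Hw, Cpow_1_l, Cmult_1_l.
    f_equal. lia.
Qed.

Definition poly (c : nat -> C) (n : nat) (z : C) : C :=
  Csum (fun k => c k * z ^ k)%C n.

Lemma poly_cross_term (m n l : nat) (c : nat -> C) (b : C) :
  (n < l <= m)%nat ->
  Csum (fun j => poly c n (unity_root m ^ j) * Cconj (b * (unity_root m ^ j) ^ l))%C m = 0.
Proof.
  intros Hl. unfold poly.
  rewrite (Csum_ext _ (fun j => Csum (fun k =>
     ((unity_root m ^ j) ^ k * Cconj ((unity_root m ^ j) ^ l)) * (c k * Cconj b))%C n)).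
  2:{ intros j _. rewrite <- Csum_mult_r. apply Csum_ext. intros k _.
      rewrite Cmult_conj. ring. }
  rewrite Csum_switch.
  rewrite (Csum_ext _ (fun _ => RtoC 0)).
  - clear. induction n as [|n IH]; [apply Csum_O | rewrite Csum_Sn, IH; ring].
  - intros k Hk. rewrite Csum_mult_r, unity_root_orthogonal by lia.
    ring.
Qed.

Lemma Cmod2_plus (x y : C) :
  Cmod (x + y) ^ 2 = Cmod x ^ 2 + Cmod y ^ 2 + 2 * Re (x * Cconj y)%C.
Proof.
  rewrite !Cmod2_alt. destruct x, y; simpl. ring.
Qed.

(** * Parseval on a circle *)

(** More sample points than coefficients: no two of the monomials involved agree
    on all the (m+1)-th roots of unity, so they are orthogonal there. *)
Lemma poly_parseval (m n : nat) (c : nat -> C) :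
  (n <= m)%nat ->
  sum_f_R0 (fun j => Cmod (poly c n (unity_root m ^ j)) ^ 2) m
  = INR (S m) * sum_f_R0 (fun k => Cmod (c k) ^ 2) n.
Proof.
  intros Hn. induction n as [|n IH].
  - rewrite (sum_eq _ (fun _ => Cmod (c 0%nat) ^ 2)).
    + rewrite sum_cte. simpl sum_f_R0. ring.
    + intros j _. unfold poly. rewrite Csum_O. simpl Cpow. now rewrite Cmult_1_r.
  - rewrite (sum_eq _ (fun j => (Cmod (poly c n (unity_root m ^ j)) ^ 2 + Cmod (c (S n)) ^ 2)
       + Re (poly c n (unity_root m ^ j) * Cconj (c (S n) * (unity_root m ^ j) ^ S n))%C * 2)).
    + rewrite plus_sum, plus_sum, <- scal_sum, <- Re_sum, poly_cross_term by lia.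
      rewrite IH by lia. rewrite sum_cte. simpl. ring.
    + intros j _. unfold poly at 1. rewrite Csum_Sn. fold (poly c n (unity_root m ^ j)%C).
      rewrite Cmod2_plus, Cmod_mult, !Cmod_pow.
      unfold unity_root at 2. rewrite Cmod_cis, !pow1. ring.
Qed.

(** * Power series on the disk *)

Lemma is_pseries_poly (c : nat -> C) (z l : C) :
  @is_pseries C_AbsRing C_NormedModule c z l <->
  (forall eps : R, 0 < eps ->
     exists N : nat, forall n : nat, (N <= n)%nat -> Cmod (poly c n z - l) < eps).
Proof.
  assert (E : forall n, sum_n (fun k => scal (pow_n (z : C_AbsRing) k) (c k : C_NormedModule)) n
                        = poly c n z).
  { intros n. apply sum_n_ext. intros k. rewrite Cmult_comm.
    reflexivity. }
  split.
  - intros H eps He.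
    pose proof (proj1 (@filterlim_locally_ball_norm C_AbsRing nat C_NormedModule
                         eventually _ _ _) H) as H1. clear H.
    destruct (H1 (mkposreal eps He)) as [N HN]. exists N. intros n Hn.
    specialize (HN n Hn). unfold ball_norm in HN. rewrite E in HN.
    exact HN.
  - intros H.
    refine (proj2 (@filterlim_locally_ball_norm C_AbsRing nat C_NormedModule
                     eventually _ _ _) _).
    intros eps. destruct (H eps (cond_pos eps)) as [N HN]. exists N. intros n Hn.
    specialize (HN n Hn). unfold ball_norm. rewrite E.
    exact HN.
Qed.

Lemma poly_Sn (c : nat -> C) (n : nat) (z : C) :
  poly c (S n) z = (poly c n z + c (S n) * z ^ S n)%C.
Proof. apply Csum_Sn. Qed.

(** A term is the difference of two partial sums, both eventually close to the
    limit; the finitely many earlier terms are bounded anyway. *)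
Lemma pseries_terms_bounded (c : nat -> C) (z l : C) :
  @is_pseries C_AbsRing C_NormedModule c z l ->
  exists B : R, forall k : nat, Cmod (c k * z ^ k) <= B.
Proof.
  intros H. apply is_pseries_poly with (eps := 1) in H; [|lra].
  destruct H as [N HN].
  assert (F : forall n, exists B, forall k, (k <= n)%nat -> Cmod (c k * z ^ k) <= B).
  { induction n as [|n [B HB]].
    - exists (Cmod (c 0%nat * z ^ 0)). intros k Hk. replace k with 0%nat by lia. lra.
    - exists (Rmax B (Cmod (c (S n) * z ^ S n))). intros k Hk.
      destruct (Nat.eq_dec k (S n)) as [->|].
      + apply Rmax_r.
      + eapply Rle_trans; [apply HB; lia | apply Rmax_l]. }
  destruct (F N) as [B HB]. exists (Rmax B 2). intros k.
  destruct (Nat.le_gt_cases k N) as [Hk|Hk].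
  - eapply Rle_trans; [apply HB, Hk | apply Rmax_l].
  - eapply Rle_trans; [|apply Rmax_r].
    destruct k as [|k]; [lia|].
    replace (c (S k) * z ^ S k)%C with ((poly c (S k) z - l) + - (poly c k z - l))%C
      by (rewrite poly_Sn; ring).
    eapply Rle_trans; [apply Cmod_triangle|]. rewrite Cmod_opp.
    assert (Cmod (poly c (S k) z - l) < 1) by (apply HN; lia).
    assert (Cmod (poly c k z - l) < 1) by (apply HN; lia). lra.
Qed.

(** Boundedness of the terms at a radius t between s and 1 makes the terms at
    radius s geometrically small, uniformly in the argument of z. *)
Lemma poly_uniform_limit (c : nat -> C) (g : C -> C) (s : R) :
  (forall z, Cmod z < 1 -> @is_pseries C_AbsRing C_NormedModule c z (g z)) ->
  0 <= s < 1 ->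
  forall eps : R, 0 < eps ->
  exists N : nat, forall n : nat, (N <= n)%nat ->
  forall z : C, Cmod z = s -> Cmod (poly c n z - g z) <= eps.
Proof.
  intros Hg Hs eps Heps.
  set (t := (1 + s) / 2).
  assert (Ht : 0 < t < 1 /\ s < t) by (unfold t; lra).
  assert (Hmt : Cmod t = t) by (rewrite Cmod_R; apply Rabs_pos_eq; lra).
  destruct (pseries_terms_bounded c t (g t)) as [B HB]; [apply Hg; lra|].
  assert (HB0 : 0 <= B) by (eapply Rle_trans; [apply Cmod_ge_0 | apply (HB 0%nat)]).
  set (q := s / t).
  assert (Hq : 0 <= q < 1).
  { unfold q. split; [apply Rdiv_le_0_compat; lra|]. apply (Rdiv_lt_1 s t); lra. }
  assert (Hqt : q * t = s) by (unfold q; field; lra).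
  assert (T : forall z k, Cmod z = s -> Cmod (c k * z ^ k) <= B * q ^ k).
  { intros z k Hz. specialize (HB k).
    rewrite Cmod_mult, Cmod_pow in *. rewrite Hz, <- Hqt, Rpow_mult_distr.
    rewrite Hmt in HB. pose proof (pow_le q k (proj1 Hq)). nra. }
  assert (P : forall z n i, Cmod z = s ->
     Cmod (poly c (n + i) z - poly c n z) <= B / (1 - q) * (q ^ S n - q ^ S (n + i))).
  { intros z n i Hz. induction i as [|i IH].
    - rewrite Nat.add_0_r.
      replace (poly c n z - poly c n z)%C with (RtoC 0) by ring.
      rewrite Cmod_0. lra.
    - replace (n + S i)%nat with (S (n + i)) by lia.
      rewrite poly_Sn.
      replace (poly c (n + i) z + c (S (n + i)) * z ^ S (n + i) - poly c n z)%C
        with ((poly c (n + i) z - poly c n z) + c (S (n + i)) * z ^ S (n + i))%C by ring.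
      eapply Rle_trans; [apply Cmod_triangle|].
      pose proof (T z (S (n + i)) Hz).
      replace (B / (1 - q) * (q ^ S n - q ^ S (S (n + i))))
        with (B / (1 - q) * (q ^ S n - q ^ S (n + i)) + B * q ^ S (n + i))
        by (simpl; field; lra).
      lra. }
  pose proof (is_lim_seq_geom q) as L. rewrite Rabs_pos_eq in L by lra.
  specialize (L (proj2 Hq)). apply is_lim_seq_spec in L.
  assert (HK : 0 < B / (1 - q) + 1).
  { assert (0 <= B / (1 - q)) by (apply Rdiv_le_0_compat; lra). lra. }
  destruct (L (mkposreal _ (Rdiv_lt_0_compat _ _ Heps HK))) as [N HN]. simpl in HN.
  exists N. intros n Hn z Hz.
  apply Rle_plus_epsilon. intros d Hd.
  destruct (proj1 (is_pseries_poly c z (g z)) (Hg z ltac:(lra)) d Hd) as [M HM].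
  specialize (HM (n + M)%nat ltac:(lia)).
  specialize (P z n M Hz).
  replace (poly c n z - g z)%C
    with (- (poly c (n + M) z - poly c n z) + (poly c (n + M) z - g z))%C by ring.
  eapply Rle_trans; [apply Cmod_triangle|]. rewrite Cmod_opp.
  specialize (HN (S n) ltac:(lia)).
  pose proof (pow_le q (S n) (proj1 Hq)). pose proof (pow_le q (S (n + M)) (proj1 Hq)).
  rewrite Rminus_0_r, Rabs_pos_eq in HN by lra.
  assert (0 <= B / (1 - q)) by (apply Rdiv_le_0_compat; lra).
  assert (q ^ S n * (B / (1 - q) + 1) < eps).
  { apply (Rmult_lt_compat_r (B / (1 - q) + 1)) in HN; [|lra].
    replace (eps / (B / (1 - q) + 1) * (B / (1 - q) + 1)) with eps in HN by (field; lra).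
    exact HN. }
  nra.
Qed.

(** A finite sum is continuous in the radius, so no convergence question arises at
    radius 1. *)
Lemma sum_le_of_radius_lt_1 (u : nat -> R) (D : R) (n : nat) :
  (forall s, 0 <= s < 1 -> sum_f_R0 (fun k => u k * (s ^ k) ^ 2) n <= D) ->
  sum_f_R0 u n <= D.
Proof.
  intros H. set (s := fun i : nat => 1 - (1 / 2) ^ i).
  assert (Hs : forall i, 0 <= s i < 1).
  { intros i. unfold s. pose proof (pow_lt (1 / 2) i ltac:(lra)).
    pose proof (pow_incr (1 / 2) 1 i ltac:(lra)) as G. rewrite pow1 in G. lra. }
  assert (L : is_lim_seq s 1).
  { unfold s. replace (Finite 1) with (Rbar_minus 1 0) by (simpl; f_equal; ring).
    apply is_lim_seq_minus'; [apply is_lim_seq_const|].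
    apply is_lim_seq_geom. rewrite Rabs_pos_eq; lra. }
  assert (L1 : forall m, is_lim_seq (fun i => sum_f_R0 (fun k => u k * (s i ^ k) ^ 2) m)
                           (sum_f_R0 u m)).
  { assert (T : forall k, is_lim_seq (fun i => u k * (s i ^ k) ^ 2) (u k)).
    { intros k. pattern (u k) at 2. replace (u k) with (u k * (1 ^ k) ^ 2) by (rewrite !pow1; ring).
      apply (is_lim_seq_continuous (fun x => u k * (x ^ k) ^ 2)); [|exact L].
      apply derivable_continuous_pt. reg. }
    induction m as [|m IH]; [apply T|].
    simpl sum_f_R0. apply is_lim_seq_plus'; [exact IH | apply T]. }
  exact (is_lim_seq_le _ _ _ _ (fun i => H (s i) (Hs i)) (L1 n) (is_lim_seq_const D)).
Qed.

(** * Coefficients of a function dominated by a binomial *)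

Definition binomial_coef (al be : C) (n k : nat) : C :=
  if Nat.eq_dec k 0 then al else if Nat.eq_dec k n then be else 0.

Lemma binomial_poly (al be z : C) (n : nat) :
  poly (binomial_coef al be (S n)) (S n) z = (al + be * z ^ S n)%C.
Proof.
  assert (H : forall m, (m <= n)%nat -> poly (binomial_coef al be (S n)) m z = al).
  { induction m as [|m IH]; intros Hm.
    - unfold poly. rewrite Csum_O. unfold binomial_coef. simpl. ring.
    - rewrite poly_Sn, IH by lia. unfold binomial_coef.
      destruct (Nat.eq_dec (S m) 0); [lia|].
      destruct (Nat.eq_dec (S m) (S n)); [lia|]. ring. }
  rewrite poly_Sn, H by lia. unfold binomial_coef.
  destruct (Nat.eq_dec (S n) 0); [lia|].
  destruct (Nat.eq_dec (S n) (S n)); [reflexivity|lia].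
Qed.

Lemma binomial_square_sum (al be : C) (n : nat) :
  sum_f_R0 (fun k => Cmod (binomial_coef al be (S n) k) ^ 2) (S n)
  = Cmod al ^ 2 + Cmod be ^ 2.
Proof.
  assert (H : forall m, (m <= n)%nat ->
    sum_f_R0 (fun k => Cmod (binomial_coef al be (S n) k) ^ 2) m = Cmod al ^ 2).
  { induction m as [|m IH]; intros Hm; [reflexivity|].
    rewrite tech5, IH by lia. unfold binomial_coef.
    destruct (Nat.eq_dec (S m) 0); [lia|].
    destruct (Nat.eq_dec (S m) (S n)); [lia|]. rewrite Cmod_0. ring. }
  rewrite tech5, H by lia. unfold binomial_coef.
  destruct (Nat.eq_dec (S n) 0); [lia|].
  destruct (Nat.eq_dec (S n) (S n)); [ring|lia].
Qed.

Lemma sum_nonneg_extend (u : nat -> R) (m n : nat) :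
  (forall k, 0 <= u k) -> (m <= n)%nat -> sum_f_R0 u m <= sum_f_R0 u n.
Proof.
  intros Hu Hmn. induction Hmn as [|n _ IH]; [lra|]. simpl. specialize (Hu (S n)). lra.
Qed.

(** Compare the mean squares of both sides over roots of unity on a circle of
    radius s < 1, with g replaced by a uniformly close partial sum, then let s
    tend to 1. *)
Lemma coef_sum_le_of_dominated (c : nat -> C) (g : C -> C) (al be : C) (n N : nat) :
  (forall z, Cmod z < 1 -> @is_pseries C_AbsRing C_NormedModule c z (g z)) ->
  (forall z, Cmod z < 1 -> Cmod (g z) <= Cmod (al + be * z ^ S n)) ->
  sum_f_R0 (fun k => Cmod (c k) ^ 2) N <= Cmod al ^ 2 + Cmod be ^ 2.
Proof.
  intros Hc Hg. apply sum_le_of_radius_lt_1. intros s Hs.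
  apply Rle_plus_epsilon. intros e He.
  set (A := Cmod al + Cmod be).
  pose proof (Cmod_ge_0 al). pose proof (Cmod_ge_0 be).
  (* For d <= 1 and p <= A, (p + d)^2 <= p^2 + d (2 A + 1): this fixes the accuracy d. *)
  set (d := Rmin 1 (e / (2 * A + 1))).
  assert (Hd : 0 < d <= 1 /\ d * (2 * A + 1) <= e).
  { assert (0 < e / (2 * A + 1)) by (apply Rdiv_lt_0_compat; unfold A; lra).
    unfold d. split; [split; [apply Rmin_glb_lt; lra | apply Rmin_l]|].
    pose proof (Rmin_r 1 (e / (2 * A + 1))) as G.
    apply (Rmult_le_compat_r (2 * A + 1)) in G; [|unfold A; lra].
    replace (e / (2 * A + 1) * (2 * A + 1)) with e in G by (field; unfold A; lra).
    exact G. }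
  destruct (poly_uniform_limit c g s Hc Hs d (proj1 (proj1 Hd))) as [L0 HL0].
  (* m exceeds both degrees L and n+1, as the discrete Parseval identity requires. *)
  set (L := (L0 + N)%nat). set (m := (L + S n)%nat).
  assert (Hpow : forall (x : C) k, (x * s ^ k)%C = (x * RtoC (s ^ k))%C)
    by (intros; now rewrite RtoC_pow).
  assert (Hmods : forall k, Cmod (s ^ k)%C = s ^ k)
    by (intros k; rewrite Cmod_pow, Cmod_R, Rabs_pos_eq; lra).
  assert (Hpoly : forall b l w, poly (fun k => b k * s ^ k)%C l w = poly b l (s * w)%C).
  { intros b l w. unfold poly. apply Csum_ext. intros k _. rewrite Cpow_mult_l. ring. }
  apply Rle_trans with (sum_f_R0 (fun k => Cmod (c k * s ^ k) ^ 2) L).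
  { rewrite (sum_eq _ (fun k => Cmod (c k * s ^ k) ^ 2)).
    - apply sum_nonneg_extend; [intros; apply pow2_ge_0 | unfold L; lia].
    - intros k _. rewrite Cmod_mult, Hmods. ring. }
  apply Rmult_le_reg_l with (INR (S m)); [apply lt_0_INR; lia|].
  rewrite <- poly_parseval by (unfold m; lia).
  apply Rle_trans with
    (sum_f_R0 (fun j => Cmod (poly (fun k => binomial_coef al be (S n) k * s ^ k)%C (S n)
                              (unity_root m ^ j)) ^ 2 + e) m).
  - apply sum_Rle. intros j _. rewrite !Hpoly, binomial_poly.
    set (z := (s * unity_root m ^ j)%C).
    assert (Hz : Cmod z = s).
    { unfold z. rewrite Cmod_mult, Cmod_pow, Cmod_R, Rabs_pos_eq by lra.
      unfold unity_root. rewrite Cmod_cis, pow1. ring. }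
    specialize (HL0 L ltac:(unfold L; lia) z Hz).
    specialize (Hg z ltac:(lra)).
    set (p := Cmod (al + be * z ^ S n)) in *.
    assert (Hp : p <= A).
    { unfold p, A. eapply Rle_trans; [apply Cmod_triangle|].
      rewrite Cmod_mult, Cmod_pow, Hz.
      pose proof (pow_incr s 1 (S n) ltac:(lra)) as G. rewrite pow1 in G. nra. }
    assert (Hp0 : 0 <= p) by apply Cmod_ge_0.
    assert (Hq : Cmod (poly c L z) <= p + d).
    { replace (poly c L z) with (g z + (poly c L z - g z))%C by ring.
      eapply Rle_trans; [apply Cmod_triangle|]. lra. }
    pose proof (Cmod_ge_0 (poly c L z)). nra.
  - rewrite plus_sum, sum_cte, poly_parseval by (unfold m; lia).
    rewrite Rmult_plus_distr_l, (Rmult_comm e). apply Rplus_le_compat_r.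
    apply Rmult_le_compat_l; [apply pos_INR|].
    rewrite <- (binomial_square_sum al be n).
    apply sum_Rle. intros k _. rewrite Cmod_mult, Hmods.
    pose proof (Cmod_ge_0 (binomial_coef al be (S n) k)).
    pose proof (pow_incr s 1 k ltac:(lra)) as G. rewrite pow1 in G.
    pose proof (pow_le s k (proj1 Hs)).
    apply pow_incr. nra.
Qed.

(** * The defect inequality *)

(** The H^2 contraction property of multiplication by f on al + be z^(n+1): the
    left side collects the coefficients of the product up to degree n+1. *)
Lemma product_coef_sum_le (f : C -> C) (a : nat -> C) (al be : C) (n : nat) :
  disk_expansion f a -> bounded_by_1_on_disk f ->
  Cmod al ^ 2 * sum_f_R0 (fun k => Cmod (a k) ^ 2) n
    + Cmod (al * a (S n) + be * a 0%nat) ^ 2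
  <= Cmod al ^ 2 + Cmod be ^ 2.
Proof.
  intros Ha Hf.
  set (c := PS_plus (PS_scal (al : C_AbsRing) (a : nat -> C_NormedModule))
              (PS_incr_n (PS_scal (be : C_AbsRing) (a : nat -> C_NormedModule)) (S n))).
  assert (Hpn : forall (z : C) k, @pow_n C_AbsRing z k = (z ^ k)%C).
  { intros z k. induction k as [|k IH]; [reflexivity|]. simpl. now rewrite IH. }
  assert (Hc : forall k, (k <= n)%nat -> c k = (al * a k)%C).
  { intros k Hk. unfold c, PS_plus. rewrite PS_incr_n_simplify.
    destruct Compare_dec.le_lt_dec; [lia|]. apply plus_zero_r. }
  assert (HcS : c (S n) = (al * a (S n) + be * a 0%nat)%C).
  { unfold c, PS_plus. rewrite PS_incr_n_simplify.
    destruct Compare_dec.le_lt_dec; [|lia]. rewrite Nat.sub_diag. reflexivity. }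
  pose proof (coef_sum_le_of_dominated c (fun z => (al + be * z ^ S n) * f z)%C al be n (S n)) as M.
  rewrite tech5 in M. rewrite HcS in M.
  rewrite (sum_eq _ (fun k => Cmod (a k) ^ 2 * Cmod al ^ 2)) in M.
  2:{ intros k Hk. rewrite (Hc k Hk), Cmod_mult. ring. }
  rewrite <- scal_sum in M. apply M.
  - intros z Hz.
    replace ((al + be * z ^ S n) * f z)%C with (al * f z + z ^ S n * (be * f z))%C by ring.
    rewrite <- Hpn.
    apply (@is_pseries_plus C_AbsRing C_NormedModule).
    + apply (@is_pseries_scal C_AbsRing C_NormedModule); [apply Cmult_comm | apply Ha, Hz].
    + apply (@is_pseries_incr_n C_AbsRing C_NormedModule).
      apply (@is_pseries_scal C_AbsRing C_NormedModule); [apply Cmult_comm | apply Ha, Hz].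
  - intros z Hz. rewrite Cmod_mult. specialize (Hf z Hz).
    pose proof (Cmod_ge_0 (al + be * z ^ S n)). nra.
Qed.

(** With be = conj(a_0) a_(n+1) and al = 1 - |a_0|^2 the coefficient
    al a_(n+1) + be a_0 collapses to a_(n+1); dividing by al gives the claim.  If
    |a_0| = 1, the choice al = 1, be = 0 already forces a_(n+1) = 0. *)
Lemma coef_defect (f : C -> C) (a : nat -> C) (n : nat) :
  disk_expansion f a -> bounded_by_1_on_disk f ->
  sum_f_R0 (fun k => Cmod (a k) ^ 2) n <= 1 /\
  Cmod (a (S n)) ^ 2
    <= (1 - Cmod (a 0%nat) ^ 2) * (1 - sum_f_R0 (fun k => Cmod (a k) ^ 2) n).
Proof.
  intros Ha Hf.
  set (Sn := sum_f_R0 (fun k => Cmod (a k) ^ 2) n).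
  set (x := Cmod (a 0%nat)). set (y := Cmod (a (S n))).
  pose proof (product_coef_sum_le f a 1 0 n Ha Hf) as H1. fold Sn in H1.
  rewrite Cmod_1, Cmod_0 in H1.
  replace (1 * a (S n) + 0 * a 0%nat)%C with (a (S n)) in H1 by ring. fold y in H1.
  assert (Hx : x ^ 2 <= Sn).
  { apply (sum_nonneg_extend (fun k => Cmod (a k) ^ 2) 0 n); [|lia].
    intros; apply pow2_ge_0. }
  split; [nra|].
  pose proof (product_coef_sum_le f a (1 - x ^ 2) (Cconj (a 0%nat) * a (S n)) n Ha Hf) as H2.
  fold Sn in H2.
  replace ((1 - x ^ 2) * a (S n) + Cconj (a 0%nat) * a (S n) * a 0%nat)%C
    with (a (S n)) in H2.
  2:{ transitivity ((1 - x ^ 2 + a 0%nat * Cconj (a 0%nat)) * a (S n))%C; [|ring].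
      rewrite <- Cmod2_conj. fold x. rewrite RtoC_pow. ring. }
  rewrite Cmod_mult, Cmod_conj in H2. fold x y in H2.
  replace (1 - x ^ 2)%C with (RtoC (1 - x ^ 2)) in H2
    by (rewrite RtoC_minus, RtoC_pow; reflexivity).
  rewrite Cmod_R, pow2_abs in H2.
  destruct (Req_dec (x ^ 2) 1) as [E|E]; [nra|].
  assert (Hu : 0 < 1 - x ^ 2) by nra.
  apply Rmult_le_reg_l with (1 - x ^ 2); [exact Hu|]. nra.
Qed.

(** * Consequences for the moduli of the coefficients *)

(** What the moduli of the coefficients of a function bounded by 1 satisfy, and
    all that the upper bound needs from it. *)
Definition defect_bounded (x : nat -> R) : Prop :=
  (forall n, 0 <= x n) /\
  (forall n, sum_f_R0 (fun k => x k ^ 2) n <= 1) /\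
  (forall n, x (S n) ^ 2 <= (1 - x 0%nat ^ 2) * (1 - sum_f_R0 (fun k => x k ^ 2) n)).

Lemma defect_bounded_head (x : nat -> R) : defect_bounded x -> 0 <= x 0%nat <= 1.
Proof.
  intros (H0 & H1 & _). specialize (H0 0%nat). specialize (H1 0%nat). simpl in H1. nra.
Qed.

(** The quantity (partial sum up to index n+1) + c rho^(n+1) D_(n+1) does not
    increase with n when c = rho (1 - a^2) / (1 - rho a^2): this c <= 1 is the
    fixed point for which the worst case x_(n+1)^2 = (1 - a^2) D_n of the defect
    inequality leaves it unchanged.  The bound is its initial value c D_0. *)
Lemma weighted_square_sum (x : nat -> R) (rho : R) (n : nat) :
  defect_bounded x -> 0 <= rho <= 1 -> rho * x 0%nat ^ 2 < 1 ->
  sum_f_R0 (fun k => x (S k) ^ 2 * rho ^ S k) n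
    <= rho * (1 - x 0%nat ^ 2) ^ 2 / (1 - rho * x 0%nat ^ 2).
Proof.
  intros Hx Hrho Hlt. pose proof (defect_bounded_head x Hx) as H01.
  destruct Hx as (_ & HS & Hstep).
  set (D := fun n => 1 - sum_f_R0 (fun k => x k ^ 2) n).
  assert (HD : forall n, 0 <= D n) by (intros k; unfold D; specialize (HS k); lra).
  set (q := x 0%nat ^ 2) in *.
  assert (Hq : 0 <= q <= 1) by (unfold q; split; nra).
  set (c := rho * (1 - q) / (1 - rho * q)).
  assert (Hc : c * (1 - rho * q) = rho * (1 - q)) by (unfold c; field; lra).
  assert (Hc0 : 0 <= c) by (unfold c; apply Rdiv_le_0_compat; nra).
  assert (Hc1 : c <= 1) by nra.
  assert (step : forall k, rho * (x (S k) ^ 2 + c * D (S k)) <= c * D k).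
  { intros k. specialize (Hstep k). fold (D k) in Hstep.
    assert (E : D (S k) = D k - x (S k) ^ 2) by (unfold D; rewrite tech5; ring).
    rewrite E. specialize (HD k).
    assert (x (S k) ^ 2 * (1 - c) <= (1 - q) * D k * (1 - c))
      by (apply Rmult_le_compat_r; [lra | exact Hstep]).
    replace (c * D k) with (rho * ((1 - q) * D k * (1 - c) + c * D k)).
    - apply Rmult_le_compat_l; lra.
    - transitivity ((rho * (1 - q) + c * (rho * q)) * D k); [ring|].
      rewrite <- Hc. ring. }
  assert (P : forall k, sum_f_R0 (fun k => x (S k) ^ 2 * rho ^ S k) k
                        + c * rho ^ S k * D (S k) <= c * D 0%nat).
  { induction k as [|k IH].
    - specialize (step 0%nat).
      change (sum_f_R0 _ 0) with (x 1%nat ^ 2 * rho ^ 1). rewrite (pow_1 rho). lra.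
    - rewrite tech5. specialize (step (S k)).
      pose proof (pow_le rho (S k) (proj1 Hrho)) as Hp.
      apply (Rmult_le_compat_l _ _ _ Hp) in step.
      replace (rho ^ S (S k)) with (rho ^ S k * rho) by (simpl; ring). lra. }
  replace (rho * (1 - q) ^ 2 / (1 - rho * q)) with (c * D 0%nat).
  - specialize (P n). specialize (HD (S n)). pose proof (pow_le rho (S n) (proj1 Hrho)).
    assert (0 <= c * rho ^ S n * D (S n))
      by (apply Rmult_le_pos; [apply Rmult_le_pos|]; assumption). lra.
  - unfold D, c. change (sum_f_R0 _ 0) with q. field. lra.
Qed.

Lemma geometric_partial_sum_le (q : R) (n : nat) :
  0 <= q < 1 -> sum_f_R0 (fun k => q ^ S k) n <= q / (1 - q).
Proof.
  intros Hq.
  assert (E : sum_f_R0 (fun k => q ^ S k) n = (q - q ^ S (S n)) / (1 - q)).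
  { induction n as [|n IH].
    - simpl. field. lra.
    - rewrite tech5, IH. simpl. field. lra. }
  rewrite E. pose proof (pow_le q (S (S n)) (proj1 Hq)).
  apply Rmult_le_compat_r; [left; apply Rinv_0_lt_compat; lra | lra].
Qed.

(** Cauchy-Schwarz in its termwise form, the free factor [lam] replacing the two
    square roots. *)
Lemma weighted_am_gm (x : nat -> R) (lam p q r : R) (n : nat) :
  0 < lam -> 0 < p -> p * q = r ^ 2 ->
  sum_f_R0 (fun k => x (S k) * r ^ S k) n
    <= (lam * sum_f_R0 (fun k => x (S k) ^ 2 * p ^ S k) n
        + / lam * sum_f_R0 (fun k => q ^ S k) n) / 2.
Proof.
  intros Hl Hp Hpq.
  rewrite !scal_sum, <- plus_sum. unfold Rdiv. rewrite Rmult_comm, scal_sum.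
  apply sum_Rle. intros k _.
  set (y := x (S k)). set (P := p ^ S k). set (Q := q ^ S k). set (T := r ^ S k).
  assert (HP : 0 < P) by (apply pow_lt; exact Hp).
  assert (E : P * Q = T ^ 2).
  { unfold P, Q, T. rewrite <- Rpow_mult_distr, Hpq, <- !pow_mult. f_equal. lia. }
  replace ((y ^ 2 * P * lam + Q * / lam) * / 2)
    with (y * T + (lam * y * P - T) ^ 2 * / (2 * lam * P)).
  - pose proof (pow2_ge_0 (lam * y * P - T)).
    assert (0 < / (2 * lam * P)) by (apply Rinv_0_lt_compat; nra). nra.
  - replace Q with (T ^ 2 / P) by (rewrite <- E; field; lra). field. lra.
Qed.

(** The weight r / a and the factor a / (1 - a^2) are those for which every term of
    the weighted inequality is an equality at x_k = (1 - a^2) a^(k-1), the moduli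
    of the coefficients of (a - z) / (1 - a z).  The hypothesis r <= a keeps the
    weight at most 1. *)
Lemma linear_sum_large_head (x : nat -> R) (r : R) (n : nat) :
  defect_bounded x -> 0 < r <= x 0%nat -> x 0%nat < 1 ->
  sum_f_R0 (fun k => x (S k) * r ^ S k) n
    <= r * (1 - x 0%nat ^ 2) / (1 - r * x 0%nat).
Proof.
  intros Hx Hr Ha. set (a := x 0%nat) in *.
  assert (Hu : 0 < 1 - a ^ 2) by nra.
  assert (Hra : r / a <= 1) by (apply Rle_div_l; lra).
  assert (Hra0 : 0 < r / a) by (apply Rdiv_lt_0_compat; lra).
  assert (Er : r / a * a ^ 2 = r * a) by (field; lra).
  eapply Rle_trans.
  { apply (weighted_am_gm x (a / (1 - a ^ 2)) (r / a) (r * a)).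
    - apply Rdiv_lt_0_compat; lra.
    - exact Hra0.
    - field. lra. }
  pose proof (weighted_square_sum x (r / a) n Hx ltac:(lra)) as Z.
  fold a in Z. rewrite Er in Z. specialize (Z ltac:(nra)).
  pose proof (geometric_partial_sum_le (r * a) n ltac:(nra)) as G.
  apply (Rmult_le_compat_l (a / (1 - a ^ 2))) in Z; [|left; apply Rdiv_lt_0_compat; lra].
  apply (Rmult_le_compat_l (/ (a / (1 - a ^ 2)))) in G;
    [|left; apply Rinv_0_lt_compat, Rdiv_lt_0_compat; lra].
  assert (0 < 1 - r * a) by nra.
  replace (a / (1 - a ^ 2) * (r / a * (1 - a ^ 2) ^ 2 / (1 - r * a)))
    with (r * (1 - a ^ 2) / (1 - r * a)) in Z by (field; lra).
  replace (/ (a / (1 - a ^ 2)) * (r * a / (1 - r * a)))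
    with (r * (1 - a ^ 2) / (1 - r * a)) in G by (field; lra).
  lra.
Qed.

(** * The inequality at radius 1/3 *)

Lemma bohr_partial_sum (x : nat -> R) (n : nat) :
  defect_bounded x ->
  x 0%nat + sum_f_R0 (fun k => (x (S k) + 1 / 2 * x (S k) ^ 2) * (1 / 3) ^ S k) n <= 1.
Proof.
  intros Hx. pose proof (defect_bounded_head x Hx) as H01.
  rewrite (sum_eq _ (fun k => x (S k) * (1 / 3) ^ S k + x (S k) ^ 2 * (1 / 3) ^ S k * (1 / 2)))
    by (intros; ring).
  rewrite plus_sum, <- scal_sum.
  set (a := x 0%nat) in *.
  assert (Ha2 : 0 <= a ^ 2 <= 1) by nra.
  pose proof (weighted_square_sum x (1 / 3) n Hx ltac:(lra)) as Y. fold a in Y.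
  specialize (Y ltac:(lra)).
  set (A := sum_f_R0 (fun k => x (S k) * (1 / 3) ^ S k) n).
  set (B := sum_f_R0 (fun k => x (S k) ^ 2 * (1 / 3) ^ S k) n) in *.
  destruct (Rle_lt_dec (1 / 3) a) as [Hge|Hlt].
  - destruct (Req_dec a 1) as [E|E].
    + assert (A = 0).
      { unfold A. rewrite (sum_eq _ (fun _ => 0)); [rewrite sum_cte; ring|].
        intros k _. destruct Hx as (_ & _ & Hx). specialize (Hx k). fold a in Hx.
        rewrite E in Hx. assert (x (S k) = 0) as -> by nra. ring. }
      rewrite E in Y. unfold Rdiv in Y. lra.
    + pose proof (linear_sum_large_head x (1 / 3) n Hx ltac:(fold a; lra) ltac:(fold a; lra)) as X.
      fold a A in X.
      assert (0 < 3 - a) by lra. assert (0 < 3 - a ^ 2) by lra.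
      replace (1 / 3 * (1 - a ^ 2) / (1 - 1 / 3 * a)) with ((1 - a ^ 2) / (3 - a)) in X
        by (field; lra).
      replace (1 / 3 * (1 - a ^ 2) ^ 2 / (1 - 1 / 3 * a ^ 2))
        with ((1 - a ^ 2) ^ 2 / (3 - a ^ 2)) in Y by (field; lra).
      assert (F : 1 - a - (1 - a ^ 2) / (3 - a) - (1 - a ^ 2) ^ 2 / (3 - a ^ 2) / 2
        = (1 - a) ^ 3 * (9 + 4 * a - a ^ 2) / (2 * (3 - a) * (3 - a ^ 2)))
        by (field; lra).
      assert (0 <= (1 - a) ^ 3 * (9 + 4 * a - a ^ 2) / (2 * (3 - a) * (3 - a ^ 2))).
      { apply Rdiv_le_0_compat; [|nra].
        apply Rmult_le_pos; [apply pow_le; lra | nra]. }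
      lra.
  - (* 3/8 is a convenient value near 1 / sqrt 8, the optimal factor at a = 0. *)
    pose proof (weighted_am_gm x (3 / 8) 1 (1 / 9) (1 / 3) n
                  ltac:(lra) ltac:(lra) ltac:(field)) as X.
    fold A in X.
    pose proof (weighted_square_sum x 1 n Hx ltac:(lra)) as Z. fold a in Z.
    specialize (Z ltac:(nra)).
    replace (1 * (1 - a ^ 2) ^ 2 / (1 - 1 * a ^ 2)) with (1 - a ^ 2) in Z by (field; nra).
    pose proof (geometric_partial_sum_le (1 / 9) n ltac:(lra)) as G.
    assert (1 / 3 * (1 - a ^ 2) ^ 2 / (1 - 1 / 3 * a ^ 2) <= 1 / 3).
    { apply Rle_div_l; nra. }
    lra.
Qed.

Lemma bohr_ineq_of_partial_sums (c : R) (a : nat -> C) (r rho : R) :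
  0 <= c -> 0 <= r <= rho ->
  (forall n, Cmod (a 0%nat) + sum_f_R0 (bohr_term c a rho) n <= 1) ->
  bohr_ineq c a r.
Proof.
  intros Hc Hr H.
  set (t := bohr_term c a r).
  assert (Ht : forall k, 0 <= t k <= bohr_term c a rho k).
  { intros k. unfold t, bohr_term.
    pose proof (Cmod_ge_0 (a (S k))). pose proof (pow2_ge_0 (Cmod (a (S k)))).
    pose proof (pow_le r (S k) (proj1 Hr)).
    split; [apply Rmult_le_pos; nra|].
    apply Rmult_le_compat_l; [nra | apply pow_incr; lra]. }
  assert (Hb : forall n, sum_n t n <= 1 - Cmod (a 0%nat)).
  { intros n. rewrite sum_n_Reals. specialize (H n).
    pose proof (sum_Rle t (bohr_term c a rho) n (fun k _ => proj2 (Ht k))). lra. }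
  assert (Hex : ex_series t).
  { destruct (ex_finite_lim_seq_incr (sum_n t) (1 - Cmod (a 0%nat))) as [l Hl].
    - intros n. rewrite sum_Sn. change plus with Rplus. specialize (Ht (S n)). lra.
    - exact Hb.
    - exists l. exact Hl. }
  split; [exact Hex|].
  assert (L : is_lim_seq (sum_n t) (Series t)) by exact (Series_correct t Hex).
  pose proof (is_lim_seq_le _ _ _ _ Hb L (is_lim_seq_const _)) as G. simpl in G. fold t. lra.
Qed.

Lemma bohr_holds_half_third : bohr_holds (1 / 2) (1 / 3).
Proof.
  intros f a _ Ha Hf r Hr Hr3.
  apply bohr_ineq_of_partial_sums with (1 / 3); [lra | lra |].
  intros n. apply (bohr_partial_sum (fun k => Cmod (a k))).
  split; [intros; apply Cmod_ge_0 | split; intros k; apply (coef_defect f a k Ha Hf)].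
Qed.

(** * Sharpness: the disk automorphisms *)

Definition moebius (a : R) (z : C) : C := ((a - z) / (1 - a * z))%C.

Definition moebius_coef (a : R) (k : nat) : C :=
  match k with O => RtoC a | S k => RtoC (- (1 - a ^ 2) * a ^ k) end.

Lemma moebius_denominator (a : R) (z : C) :
  0 <= a < 1 -> Cmod z < 1 -> 1 - a <= Cmod (1 - a * z) /\ (1 - a * z)%C <> 0.
Proof.
  intros Ha Hz.
  assert (H : 1 - a <= Cmod (1 - a * z)).
  { pose proof (Cmod_triangle (1 - a * z) (a * z)) as T.
    replace (1 - a * z + a * z)%C with (RtoC 1) in T by ring.
    rewrite Cmod_1, Cmod_mult, Cmod_R, Rabs_pos_eq in T by lra. nra. }
  split; [exact H|]. apply Cmod_gt_0. lra.
Qed.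

(** |1 - a z|^2 - |a - z|^2 = (1 - a^2) (1 - |z|^2). *)
Lemma moebius_bounded (a : R) : 0 <= a < 1 -> bounded_by_1_on_disk (moebius a).
Proof.
  intros Ha z Hz. destruct (moebius_denominator a z Ha Hz) as [Hd Hn].
  unfold moebius. rewrite Cmod_div by exact Hn. apply Rle_div_l; [lra|].
  rewrite Rmult_1_l. pose proof (Cmod_ge_0 z).
  assert (E : Cmod (1 - a * z) ^ 2 - Cmod (a - z) ^ 2 = (1 - a ^ 2) * (1 - Cmod z ^ 2)).
  { rewrite !Cmod2_alt. destruct z as [u v]; simpl. ring. }
  pose proof (Cmod_ge_0 (a - z)).
  assert (0 <= (1 - a ^ 2) * (1 - Cmod z ^ 2)) by (apply Rmult_le_pos; nra).
  nra.
Qed.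

Lemma moebius_partial_sum (a : R) (z : C) (n : nat) :
  (1 - a * z)%C <> 0 ->
  poly (moebius_coef a) n z
  = (moebius a z + RtoC ((1 - a ^ 2) * a ^ n) * z ^ S n / (1 - a * z))%C.
Proof.
  intros Hn. induction n as [|n IH].
  - unfold poly, moebius. rewrite Csum_O. simpl.
    rewrite Rmult_1_r, Rmult_1_r, RtoC_minus, RtoC_mult. field. exact Hn.
  - rewrite poly_Sn, IH. unfold moebius_coef, moebius.
    rewrite !RtoC_mult, RtoC_opp, <- !tech_pow_Rmult, !Cpow_S, RtoC_mult. field. exact Hn.
Qed.

Lemma moebius_expansion (a : R) : 0 <= a < 1 -> disk_expansion (moebius a) (moebius_coef a).
Proof.
  intros Ha z Hz. destruct (moebius_denominator a z Ha Hz) as [Hd Hn].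
  apply is_pseries_poly. intros eps He.
  pose proof (Cmod_ge_0 z) as Hz0.
  pose proof (is_lim_seq_geom (Cmod z)) as L. rewrite Rabs_pos_eq in L by lra.
  specialize (L Hz). apply is_lim_seq_spec in L.
  assert (He' : 0 < eps * (1 - a)) by nra.
  destruct (L (mkposreal _ He')) as [N HN]. simpl in HN.
  exists N. intros n Hle. rewrite moebius_partial_sum by exact Hn.
  match goal with |- Cmod (?u + ?v - ?u) < _ => replace (u + v - u)%C with v by ring end.
  rewrite Cmod_div, Cmod_mult, Cmod_R, Cmod_pow by exact Hn.
  apply Rlt_div_l; [lra|].
  specialize (HN (S n) ltac:(lia)).
  pose proof (pow_le (Cmod z) (S n) Hz0). rewrite Rminus_0_r, Rabs_pos_eq in HN by assumption.
  pose proof (pow_le a n (proj1 Ha)).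
  pose proof (pow_incr a 1 n ltac:(lra)) as G. rewrite pow1 in G.
  assert (Ha2 : 0 <= 1 - a ^ 2 <= 1) by nra.
  assert (0 <= (1 - a ^ 2) * a ^ n <= 1).
  { split; [apply Rmult_le_pos; lra|]. rewrite <- (Rmult_1_r 1). apply Rmult_le_compat; lra. }
  rewrite Rabs_pos_eq by lra. nra.
Qed.

(** The error of the linear approximation at z is
    - (1 - a^2) a (y - z)^2 / ((1 - a y) (1 - a z)^2), and the denominator stays
    above (1 - a)^3 on the disk. *)
Lemma moebius_analytic (a : R) : 0 <= a < 1 -> analytic_on_disk (moebius a).
Proof.
  intros Ha z Hz. destruct (moebius_denominator a z Ha Hz) as [Hd Hn].
  set (l := (- RtoC (1 - a ^ 2) / ((1 - a * z) * (1 - a * z)))%C).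
  exists l. split; [apply is_linear_scal_l|].
  intros x Hx.
  pose proof (@is_filter_lim_locally_unique C_AbsRing (AbsRing_NormedModule C_AbsRing) z x Hx)
    as <-.
  intros eps.
  set (K := (1 - a) ^ 3).
  assert (HK : 0 < K) by (apply pow_lt; lra).
  assert (Hr : 0 < Rmin (1 - Cmod z) (eps * K)).
  { apply Rmin_glb_lt; [lra|]. apply Rmult_lt_0_compat; [apply eps | exact HK]. }
  apply (filter_imp (fun y : C => Cmod (y - z) < Rmin (1 - Cmod z) (eps * K))).
  2:{ apply (@locally_ball_norm C_AbsRing (AbsRing_NormedModule C_AbsRing) z (mkposreal _ Hr)). }
  intros y Hy.
  change (Cmod (moebius a y - moebius a z - (y - z) * l) <= eps * Cmod (y - z)).
  assert (Hy1 : Cmod y < 1).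
  { replace y with (z + (y - z))%C by ring.
    pose proof (Cmod_triangle z (y - z)). pose proof (Rmin_l (1 - Cmod z) (eps * K)). lra. }
  pose proof (Rmin_r (1 - Cmod z) (eps * K)) as HyK.
  destruct (moebius_denominator a y Ha Hy1) as [Hdy Hny].
  replace (moebius a y - moebius a z - (y - z) * l)%C
    with (- RtoC ((1 - a ^ 2) * a) * ((y - z) * (y - z))
          / ((1 - a * y) * ((1 - a * z) * (1 - a * z))))%C.
  2:{ unfold l, moebius. rewrite RtoC_mult, RtoC_minus, RtoC_pow. field. auto. }
  rewrite Cmod_div by (repeat apply Cmult_neq_0; assumption).
  rewrite !Cmod_mult, Cmod_opp, Cmod_R.
  assert (Hden : K <= Cmod (1 - a * y) * (Cmod (1 - a * z) * Cmod (1 - a * z))).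
  { unfold K. replace ((1 - a) ^ 3) with ((1 - a) * ((1 - a) * (1 - a))) by ring.
    repeat (apply Rmult_le_compat; try nra). }
  apply Rle_div_l; [lra|].
  set (h := Cmod (y - z)) in *. assert (0 <= h) by apply Cmod_ge_0.
  assert (0 <= (1 - a ^ 2) * a <= 1) by (split; nra).
  rewrite Rabs_pos_eq by lra.
  pose proof (cond_pos eps).
  apply Rle_trans with (h * (eps * K)); [nra|].
  replace (h * (eps * K)) with (eps * h * K) by ring.
  apply Rmult_le_compat_l; [nra | exact Hden].
Qed.

Lemma moebius_bohr_sum (a c r : R) :
  0 <= a < 1 -> 0 <= r < 1 ->
  Series (bohr_term c (moebius_coef a) r)
  = (1 - a ^ 2) * r / (1 - a * r) + c * (1 - a ^ 2) ^ 2 * r / (1 - a ^ 2 * r).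
Proof.
  intros Ha Hr. apply is_series_unique.
  assert (Ha2 : 0 <= a ^ 2 < 1) by nra.
  assert (E : forall k, bohr_term c (moebius_coef a) r k
     = (1 - a ^ 2) * r * (a * r) ^ k + c * (1 - a ^ 2) ^ 2 * r * (a ^ 2 * r) ^ k).
  { intros k. unfold bohr_term, moebius_coef. rewrite Cmod_R.
    pose proof (pow_le a k (proj1 Ha)).
    rewrite <- Ropp_mult_distr_l, Rabs_Ropp, Rabs_pos_eq by nra.
    assert (E : (a ^ 2) ^ k = (a ^ k) ^ 2) by (rewrite <- !pow_mult; f_equal; lia).
    rewrite !Rpow_mult_distr, E. change (r ^ S k) with (r * r ^ k). ring. }
  apply (is_series_ext (fun k =>
     plus (scal ((1 - a ^ 2) * r) ((a * r) ^ k)) (scal (c * (1 - a ^ 2) ^ 2 * r) ((a ^ 2 * r) ^ k)))).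
  { intros k. symmetry. apply E. }
  apply (is_series_plus (V := R_NormedModule)).
  - apply (is_series_scal (V := R_NormedModule)), is_series_geom.
    rewrite Rabs_pos_eq; nra.
  - apply (is_series_scal (V := R_NormedModule)), is_series_geom.
    rewrite Rabs_pos_eq; nra.
Qed.

Lemma bohr_holds_moebius (c rho a r : R) :
  bohr_holds c rho -> 0 <= a < 1 -> 0 <= r < 1 -> r <= rho ->
  a + ((1 - a ^ 2) * r / (1 - a * r) + c * (1 - a ^ 2) ^ 2 * r / (1 - a ^ 2 * r)) <= 1.
Proof.
  intros H Ha Hr Hrho.
  destruct (H (moebius a) (moebius_coef a) (moebius_analytic a Ha) (moebius_expansion a Ha)
              (moebius_bounded a Ha) r Hr Hrho) as [_ G].
  rewrite moebius_bohr_sum in G by assumption.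
  unfold moebius_coef in G at 1. rewrite Cmod_R, Rabs_pos_eq in G by lra. exact G.
Qed.

(** Already the linear part exceeds 1 - a as soon as r (1 + 2 a) > 1, which some
    a < 1 satisfies when r > 1/3. *)
Lemma radius_third_sharp (rho : R) : 1 / 3 < rho -> ~ bohr_holds (1 / 2) rho.
Proof.
  intros Hrho H.
  set (r := Rmin rho (1 / 2)).
  assert (Hr : 1 / 3 < r <= 1 / 2)
    by (unfold r; split; [apply Rmin_glb_lt; lra | apply Rmin_r]).
  (* The midpoint of (1/r - 1)/2, where r (1 + 2 a) = 1, and 1. *)
  set (a := (/ r + 1) / 4).
  assert (Har : 4 * a * r = 1 + r) by (unfold a; field; lra).
  assert (Ha : 0 <= a < 1) by nra.
  pose proof (bohr_holds_moebius (1 / 2) rho a r H Ha ltac:(lra) (Rmin_l _ _)) as G.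
  assert (Ha2 : 0 < 1 - a ^ 2) by nra.
  assert (D1 : 0 < 1 - a * r) by nra.
  assert (D2 : 0 < 1 - a ^ 2 * r) by nra.
  assert (0 <= 1 / 2 * (1 - a ^ 2) ^ 2 * r / (1 - a ^ 2 * r))
    by (apply Rdiv_le_0_compat; [|exact D2]; pose proof (pow2_ge_0 (1 - a ^ 2)); nra).
  assert (1 - a < (1 - a ^ 2) * r / (1 - a * r)).
  { apply Rlt_div_r; [exact D1|].
    replace ((1 - a ^ 2) * r) with ((1 - a) * ((1 + a) * r)) by ring.
    apply Rmult_lt_compat_l; nra. }
  lra.
Qed.

(** With a = 1 - t the sum exceeds 1 by t^2 / ((2 + t) (2 + 2 t - t^2)) times
    c (2 - t)^2 (2 + t) - 2 (2 + 2 t - t^2), which tends to 8 c - 4 as t tends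
    to 0. *)
Lemma coefficient_half_sharp (c : R) : 1 / 2 < c -> ~ bohr_holds c (1 / 3).
Proof.
  intros Hc H.
  set (d := c - 1 / 2). assert (Hd : 0 < d) by (unfold d; lra).
  (* Small enough compared with d for that factor to stay positive. *)
  set (t := d / (1 + d)).
  assert (Htd : t * (1 + d) = d) by (unfold t; field; lra).
  assert (Ht : 0 < t < 1) by nra.
  pose proof (bohr_holds_moebius c (1 / 3) (1 - t) (1 / 3) H ltac:(lra) ltac:(lra) ltac:(lra)) as G.
  assert (D1 : 0 < 2 + t) by lra.
  assert (D2 : 0 < 2 + 2 * t - t ^ 2) by nra.
  assert (E : 1 - t + ((1 - (1 - t) ^ 2) * (1 / 3) / (1 - (1 - t) * (1 / 3))
       + c * (1 - (1 - t) ^ 2) ^ 2 * (1 / 3) / (1 - (1 - t) ^ 2 * (1 / 3))) - 1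
    = t ^ 2 * (c * ((2 - t) ^ 2 * (2 + t)) - 2 * (2 + 2 * t - t ^ 2))
      / ((2 + t) * (2 + 2 * t - t ^ 2))) by (field; lra).
  assert (0 < t ^ 2 * (c * ((2 - t) ^ 2 * (2 + t)) - 2 * (2 + 2 * t - t ^ 2))
      / ((2 + t) * (2 + 2 * t - t ^ 2))).
  { apply Rdiv_lt_0_compat; [|nra]. apply Rmult_lt_0_compat; [nra|].
    replace c with (1 / 2 + d) by (unfold d; lra).
    replace ((1 / 2 + d) * ((2 - t) ^ 2 * (2 + t)) - 2 * (2 + 2 * t - t ^ 2))
      with ((1 / 2 + d) * t ^ 3 + (2 * t + t ^ 2 + 2 * (d * t) + 2 * (d * t) * (1 - t))
            + 8 * (d - t * (1 + d))) by field.
    rewrite Htd.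
    assert (0 < (1 / 2 + d) * t ^ 3) by (apply Rmult_lt_0_compat; [lra | apply pow_lt; lra]).
    assert (0 < d * t) by (apply Rmult_lt_0_compat; lra).
    assert (0 < d * t * (1 - t)) by (apply Rmult_lt_0_compat; lra).
    nra. }
  lra.
Qed.

Theorem theorem4 :
  bohr_holds (1 / 2) (1 / 3) /\
  (forall rho : R, 1 / 3 < rho -> ~ bohr_holds (1 / 2) rho) /\
  (forall c : R, 1 / 2 < c -> ~ bohr_holds c (1 / 3)).
Proof.
  exact (conj bohr_holds_half_third (conj radius_third_sharp coefficient_half_sharp)).
Qed.
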